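(* Let $a\in[0,2]$ and let $K_a=\{x\in[0,1]: r(x)=a \text{ and the frequencies } \nu_1(x),\nu_2(x) \text{ exist}\}$. Then $K_a$ has the cardinality of the continuum and is dense in $[0,1]$; its Lebesgue measure is $0$ if $a\neq1$ and $1$ if $a=1$; and its Hausdorff dimension satisfies $$\dim_H K_a\ \ge\ -\frac{1}{\ln 3}\ln\Biggl[\left(\frac{t-1}{3}\right)^{\frac{t-1}{3}}\left(\frac{7-3a-t}{6}\right)^{\frac{7-3a-t}{6}}\left(\frac{1+3a-t}{6}\right)^{\frac{1+3a-t}{6}}\Biggr],$$ where $t=\sqrt{1+6a-3a^2}$ (with the convention $0^0=1$).
   Context: Every $x\in[0,1]$ is written in base $3$ as $x=\sum_{n\ge1}\alpha_n 3^{-n}$ with $\alpha_n=\alpha_n(x)\in\{0,1,2\}$; for ternary rational numbers one always uses the representation ending in the period $(0)$. $N_i(x,k)=\#\{j\le k:\alpha_j(x)=i\}$, $\nu_i(x)=\lim_{k\to\infty}N_i(x,k)/k$ (frequency of the digit $i$, when the limit exists), and $r(x)=\lim_{n\to\infty}\frac1n\sum_{j=1}^n\alpha_j(x)$ (asymptotic mean of digits, when the limit exists). The Hausdorff–Besicovitch dimension is the Hausdorff dimension $\dim_H$. *)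

(* Defs.v *)
From HB Require Import structures.
From mathcomp Require Import all_boot all_order all_algebra.
From mathcomp Require Import all_classical all_reals all_analysis.

Set Implicit Arguments.
Unset Strict Implicit.
Unset Printing Implicit Defensive.
Import Order.TTheory GRing.Theory Num.Theory.
Import numFieldNormedType.Exports.

Local Open Scope classical_set_scope.
Local Open Scope ring_scope.

(* Digit sequences are indexed from 0: [al n] is the (n+1)-st ternary digit,
   the coefficient of 3^-(n+1). *)
Definition ternary_expansion (R : realType) (x : R) (al : nat -> 'I_3) : Prop :=
  series (fun n => (al n)%:R / 3 ^+ n.+1 : R) @ \oo --> x.

Definition ends_in_zeros (al : nat -> 'I_3) : Prop :=
  exists m, forall n, (m <= n)%N -> al n = ord0.

(* If x has an expansion ending in the period (0), the chosen one must end in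
   (0). The point 1 has no such expansion; its only one is 222... *)
Definition canonical_expansion (R : realType) (x : R) (al : nat -> 'I_3) : Prop :=
  ternary_expansion x al /\
  ((exists be, ternary_expansion x be /\ ends_in_zeros be) -> ends_in_zeros al).

(* The default value matters only for x outside [0, 1]. *)
Definition ternary_digit (R : realType) (x : R) : nat -> 'I_3 :=
  xget (fun=> ord0) [set al | canonical_expansion x al].

Definition digit_count (R : realType) (i : nat) (x : R) (k : nat) : nat :=
  #|[set j : 'I_k | ternary_digit x j == i :> nat]%SET|.

(* The limits of the next two sequences are the frequency of the digit i and
   the asymptotic mean of the digits; their terms of index 0 are junk. *)
Definition rel_freq (R : realType) (i : nat) (x : R) : R^nat :=
  fun k => (digit_count i x k)%:R / k%:R.

Definition digit_mean (R : realType) (x : R) : R^nat :=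
  fun n => n%:R^-1 * \sum_(j < n) (ternary_digit x j)%:R.

Definition Kset (R : realType) (a : R) : set R :=
  [set x | [/\ x \in `[0, 1], digit_mean x @ \oo --> a,
               cvgn (rel_freq 1 x) & cvgn (rel_freq 2 x)]].

(* Membership in the domain of [completed_lebesgue_measure], which is the
   Caratheodory sigma-algebra of the outer measure induced by length. *)
Definition lebesgue_measurable (R : realType) (A : set R) : Prop :=
  (wlength (@idfun R))^*%mu.-cara.-measurable A.

Local Open Scope ereal_scope.

Definition diam (R : realType) (A : set R) : \bar R :=
  ereal_sup [set d | exists x y, [/\ A x, A y & d = `|x - y|%:E]].

(* diam(A)^s, with 0^0 = 1, except that the empty set contributes 0 for every s
   (its [diam] above is -oo). *)
Definition diam_pow (R : realType) (s : R) (A : set R) : \bar R :=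
  if A == set0 then 0 else diam A `^ s.

Definition hausdorff_content (R : realType) (s d : R) (A : set R) : \bar R :=
  ereal_inf [set \sum_(0 <= k <oo) diam_pow s (U k) |
    U in [set U : (set R)^nat |
           (forall k, diam (U k) <= d%:E) /\ A `<=` \bigcup_k U k]].

Definition hausdorff_measure (R : realType) (s : R) (A : set R) : \bar R :=
  ereal_sup [set hausdorff_content s d A | d in [set d : R | (0 < d)%R]].

Definition hausdorff_dim (R : realType) (A : set R) : \bar R :=
  ereal_inf [set s%:E |
    s in [set s : R | (0 <= s)%R /\ hausdorff_measure s A = 0]].

(* Main.v *)
Require Import Defs.
From HB Require Import structures.
From mathcomp Require Import all_boot all_order all_algebra.
From mathcomp Require Import all_classical all_reals all_analysis.
From mathcomp Require Import ring lra zify.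
Import Order.TTheory GRing.Theory Num.Theory.
Import numFieldNormedType.Exports.

(** A probability vector [p] on the digits weighs a ternary word [w] by the
    product [p(w)]. If a nonnegative cost function [c] on words has total cost
    less than 1, some infinite digit sequence has only prefixes with
    [c w < p(w)]. Chernoff's inequality provides, for a [p]-centered function
    [g] of the digit, a cost of arbitrarily small total which is at least [p(w)]
    on all long words whose sum of [g] exceeds a given fraction of their length.
    - Lebesgue measure: for [p = (1/3, 1/3, 1/3)], the points whose digit
      frequencies do not all tend to 1/3 are covered by the cylinders of words
      with [p(w) <= c w], so they form a null set.
    - Dimension: the [p_i] of the statement have mean [a], and the bound is
      [h = - sum p_i ln p_i / ln 3]. If [s < s' < h], a cover of [K_a] with
      small [sum diam^s] gives a cost of small total equal to [3^(-n s')] on the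
      words of length [n] that meet a set of diameter about [3^(-n)]. A
      sequence avoiding it and the deviation costs of the digit frequencies and
      of [ln p_i] defines a point of [K_a] outside the cover.
    - Cardinality and density: in one explicit sequence with digits 0 and 2 and
      mean [a], finitely many digits and the digits at the square positions can
      be chosen freely. *)

Set Implicit Arguments.
Unset Strict Implicit.
Unset Printing Implicit Defensive.
Local Open Scope classical_set_scope.
Local Open Scope ring_scope.

(** * Costs and weights of finite ternary words *)

Section word_costs.
Context {R : realType}.
Local Open Scope ereal_scope.
Implicit Types (c : seq 'I_3 -> \bar R) (p : 'I_3 -> R) (w u : seq 'I_3).

(** Letters are appended at the end, so that a level splits over the three one-letter extensions of
    [u], as weights do. *)
Fixpoint level_sum c n u : \bar R :=
  if n is n'.+1 then \sum_(i < 3) level_sum c n' (rcons u i) else c u.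

Definition total_cost c u : \bar R := \sum_(n <oo) level_sum c n u.

Definition weight p w : R := (\prod_(i <- w) p i)%R.

Lemma weight_rcons p w i : weight p (rcons w i) = (weight p w * p i)%R.
Proof. by rewrite /weight big_rcons. Qed.

Lemma weight_ge0 p w : (forall i, 0 <= p i)%R -> (0 <= weight p w)%R.
Proof. by move=> p0; rewrite /weight prodr_ge0. Qed.

Lemma level_sum_ge0 c n u : (forall w, 0 <= c w) -> 0 <= level_sum c n u.
Proof. by move=> c0; elim: n u => //= n IH u; apply: sume_ge0. Qed.

Lemma total_cost_ge0 c u : (forall w, 0 <= c w) -> 0 <= total_cost c u.
Proof. by move=> c0; apply: nneseries_ge0 => n _ _; exact: level_sum_ge0. Qed.

Lemma le_level_sum c1 c2 n u : (forall w, size w = (size u + n)%N -> c1 w <= c2 w) ->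
  level_sum c1 n u <= level_sum c2 n u.
Proof.
elim: n u => /= [u|n IH u c12]; first by apply; rewrite addn0.
apply: lee_sum => i _; apply: IH => w sw; apply: c12.
by rewrite sw size_rcons addSnnS.
Qed.

Lemma eq_level_sum c1 c2 n u : (forall w, size w = (size u + n)%N -> c1 w = c2 w) ->
  level_sum c1 n u = level_sum c2 n u.
Proof.
by move=> c12; apply/eqP; rewrite eq_le !le_level_sum// => w /c12 ->.
Qed.

Lemma level_sumD c1 c2 n u : (forall w, 0 <= c1 w) -> (forall w, 0 <= c2 w) ->
  level_sum (fun w => c1 w + c2 w) n u = level_sum c1 n u + level_sum c2 n u.
Proof.
move=> c10 c20; elim: n u => //= n IH u.
by rewrite -big_split; apply: eq_bigr.
Qed.

Lemma level_sumZ (k : R) c n u : (forall w, 0 <= c w) ->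
  level_sum (fun w => k%:E * c w) n u = k%:E * level_sum c n u.
Proof.
move=> c0; elim: n u => //= n IH u; rewrite ge0_sume_distrr.
  by apply: eq_bigr.
by move=> i _; exact: level_sum_ge0.
Qed.

Lemma level_sum_nneseries (c : nat -> seq 'I_3 -> \bar R) n u :
  (forall k w, 0 <= c k w) ->
  level_sum (fun w => \sum_(k <oo) c k w) n u = \sum_(k <oo) level_sum (c k) n u.
Proof.
move=> c0; elim: n u => //= n IH u; rewrite nneseries_sum.
  by apply: eq_bigr.
by move=> i k _; exact: level_sum_ge0.
Qed.

Lemma level_sum_weight (f : 'I_3 -> R) n u :
  level_sum (fun w => (weight f w)%:E) n u = (weight f u * (\sum_i f i) ^+ n)%:E.
Proof.
elim: n u => [u|n IH u] /=; first by rewrite expr0 mulr1.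
under eq_bigr do rewrite IH weight_rcons.
rewrite sumEFin; congr _%:E; rewrite exprS.
by rewrite -mulr_suml -mulr_sumr mulrA.
Qed.

Lemma total_costD c1 c2 u : (forall w, 0 <= c1 w) -> (forall w, 0 <= c2 w) ->
  total_cost (fun w => c1 w + c2 w) u = total_cost c1 u + total_cost c2 u.
Proof.
move=> c10 c20; rewrite /total_cost -nneseriesD; first last.
- by move=> n _ _; exact: level_sum_ge0.
- by move=> n _ _; exact: level_sum_ge0.
by apply: eq_eseriesr => n _; rewrite level_sumD.
Qed.

Lemma total_cost_nneseries (c : nat -> seq 'I_3 -> \bar R) u :
  (forall k w, 0 <= c k w) ->
  total_cost (fun w => \sum_(k <oo) c k w) u = \sum_(k <oo) total_cost (c k) u.
Proof.
move=> c0; rewrite /total_cost; under eq_eseriesr do rewrite level_sum_nneseries//.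
by rewrite nneseries_interchange// => n k; exact: level_sum_ge0.
Qed.

Lemma total_cost_rec c u : (forall w, 0 <= c w) ->
  total_cost c u = c u + \sum_(i < 3) total_cost c (rcons u i).
Proof.
move=> c0; rewrite {1}/total_cost nneseries_recl//; last first.
  by move=> k _; exact: level_sum_ge0.
congr (_ + _); rewrite -nneseries_sum; last first.
  by move=> i n _; exact: level_sum_ge0.
rewrite -(@nneseries_addn _ _ 1); last by move=> i; exact: level_sum_ge0.
by apply: eq_eseriesr => n _; rewrite addn1.
Qed.

Lemma total_cost_ge c u : (forall w, 0 <= c w) -> c u <= total_cost c u.
Proof.
move=> c0; rewrite total_cost_rec// leeDl// sume_ge0// => i _.
exact: total_cost_ge0.
Qed.

(* A word [u] with [total_cost c u < weight p u] has a one-letter extension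
   with the same property, since weights are additive and costs superadditive
   over the three extensions. This replaces both a Bernoulli measure on digit
   sequences and a compactness argument. *)
Lemma exists_cheap_sequence c p : (forall w, 0 <= c w) ->
  (\sum_i p i = 1)%R -> total_cost c [::] < 1 ->
  exists al : nat -> 'I_3, forall n, c (mkseq al n) < (weight p (mkseq al n))%:E.
Proof.
move=> c0 p1 cost_lt.
have step u : total_cost c u < (weight p u)%:E ->
    exists i, total_cost c (rcons u i) < (weight p (rcons u i))%:E.
  move=> cu; apply: contrapT => /forallNP allge.
  move: cu; apply/negP; rewrite -leNgt total_cost_rec//.
  apply: (@le_trans _ _ (\sum_(i < 3) total_cost c (rcons u i))); last exact: leeDr.
  have -> : (weight p u)%:E = \sum_(i < 3) (weight p (rcons u i))%:E.
    rewrite sumEFin; under [in RHS]eq_bigr do rewrite weight_rcons.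
    by rewrite -mulr_sumr p1 mulr1.
  by apply: lee_sum => i _; rewrite leNgt; apply/negP.
pose next u := xget ord0 [set i | total_cost c (rcons u i) < (weight p (rcons u i))%:E].
have nextP u : total_cost c u < (weight p u)%:E ->
    total_cost c (rcons u (next u)) < (weight p (rcons u (next u)))%:E.
  by move=> /step[i iP]; rewrite /next; case: xgetP => [j _ //|/(_ i)].
pose W := fix W n := if n is n'.+1 then rcons (W n') (next (W n')) else [::].
have WP n : total_cost c (W n) < (weight p (W n))%:E.
  by elim: n => [|n IH] /=; [rewrite /weight big_nil|exact: nextP].
have WE n : W n = mkseq (fun k => next (W k)) n.
  by elim: n => //= n IH; rewrite mkseqS -IH.
exists (fun k => next (W k)) => n; rewrite -WE.
by apply: le_lt_trans (WP n); exact: total_cost_ge.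
Qed.

End word_costs.

(** * Chernoff bounds as word costs *)

Lemma expR_le_quadratic {R : realType} (y : R) :
  `|y| <= 1 / 2 -> expR y <= 1 + y + 2 * y ^+ 2.
Proof.
rewrite ler_norml => /andP[y1 y2].
(* Inverting this bounds [expR y] by [1 / (1 - y)]; the quadratic times [1 - y] is
   [1 + y ^+ 2 * (1 - 2 * y)], at least 1. *)
have h1 : 1 - y <= (expR y)^-1 by rewrite -expRN expR_ge1Dx.
have y3 : 0 < 1 - y by lra.
apply: (@le_trans _ _ (1 - y)^-1).
  by rewrite -[expR y]invrK lef_pV2// posrE invr_gt0 expR_gt0.
rewrite -[leLHS]div1r ler_pdivrMr//.
have -> : (1 + y + 2 * y ^+ 2) * (1 - y) = 1 + y ^+ 2 * (1 - 2 * y) by ring.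
by rewrite lerDl mulr_ge0 ?sqr_ge0//; lra.
Qed.

Lemma nneseries_le_bound {R : realType} (u : nat -> \bar R) (L : \bar R) :
  (forall n, 0 <= u n)%E -> (forall N, \sum_(0 <= k < N) u k <= L)%E ->
  (\sum_(k <oo) u k <= L)%E.
Proof.
move=> u0 uL; apply: lime_le; first exact: is_cvg_nneseries.
exact: nearW.
Qed.

Lemma nneseries_ge_term {R : realType} (u : nat -> \bar R) m :
  (forall n, 0 <= u n)%E -> (u m <= \sum_(k <oo) u k)%E.
Proof.
move=> u0; apply: (@le_trans _ _ (\sum_(0 <= k < m.+1) u k)%E).
  by rewrite big_nat_recr//= leeDr// sume_ge0.
exact: nneseries_lim_ge.
Qed.

Section deviations.
Context {R : realType}.
Variable p : 'I_3 -> R.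
Hypothesis p_ge0 : forall i, 0 <= p i.
Hypothesis sum_p : \sum_i p i = 1.

(** Since [g] is centered, the exponential moment is at most [1 - l * e] plus an error quadratic in
    [l], which is below 1 for small [l]. *)
Lemma chernoff_rate (g : 'I_3 -> R) (e : R) : \sum_i p i * g i = 0 -> 0 < e ->
  exists2 l : R, 0 < l & \sum_i p i * expR (l * (g i - e)) < 1.
Proof.
move=> g0 e0; pose B : R := 1 + e + \sum_i `|g i|.
have gB i : `|g i - e| <= B.
  rewrite (le_trans (ler_normB _ _))// (gtr0_norm e0) /B (bigD1 i)//=.
  have : 0 <= \sum_(j | j != i) `|g j| by apply: sumr_ge0.
  lra.
have B1 : 1 <= B.
  have : 0 <= \sum_i `|g i| by apply: sumr_ge0.
  rewrite /B; lra.
have eB : e <= B.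
  have : 0 <= \sum_i `|g i| by apply: sumr_ge0.
  rewrite /B; lra.
(* With this [l] the error [2 * (l * B) ^+ 2] is half of [l * e], and [l * B <= 1 / 4] keeps the
   exponents in the range of the quadratic bound. *)
pose l := e / (4 * B ^+ 2).
have B2 : 0 < 4 * B ^+ 2 by nra.
have l0 : 0 < l by rewrite divr_gt0.
have lE : l * (4 * B ^+ 2) = e by rewrite /l divfK// gt_eqF.
have lB : l * B <= 1 / 4.
  rewrite /l mulrAC ler_pdivrMr//; nra.
exists l => //.
apply: (@le_lt_trans _ _ (\sum_i (p i * (1 - l * e + 2 * (l * B) ^+ 2)
    + l * (p i * g i)))).
  apply: ler_sum => i _.
  have -> : p i * (1 - l * e + 2 * (l * B) ^+ 2) + l * (p i * g i) =
      p i * (1 + l * (g i - e) + 2 * (l * B) ^+ 2) by ring.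
  apply: ler_wpM2l => //.
  have h : `|l * (g i - e)| <= l * B.
    by rewrite normrM (gtr0_norm l0) ler_wpM2l// ltW.
  apply: le_trans (expR_le_quadratic _) _; first by apply: le_trans h _; lra.
  rewrite lerD2l ler_wpM2l// -real_normK ?num_real//.
  by rewrite lerXn2r ?nnegrE// (le_trans _ h).
rewrite big_split/= -mulr_suml sum_p -mulr_sumr g0 mulr0 addr0 mul1r.
have -> : (l * B) ^+ 2 = l * e / 4 by rewrite -lE; field.
have : 0 < l * e by rewrite mulr_gt0.
lra.
Qed.

Lemma weight_expR (g : 'I_3 -> R) (l e : R) w :
  weight (fun i => p i * expR (l * (g i - e))) w =
  weight p w * expR (l * (\sum_(i <- w) g i - e * (size w)%:R)).
Proof.
rewrite /weight big_split/= -expR_sum; congr (_ * expR _).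
rewrite -mulr_sumr sumrB; congr (_ * (_ - _)).
by rewrite big_const_seq count_predT iter_addr addr0 mulr_natr.
Qed.

Lemma geometric_tail_le (q : R) M N : 0 <= q < 1 ->
  \sum_(0 <= n < N) (M <= n)%:R * q ^+ n <= q ^+ M / (1 - q).
Proof.
move=> /andP[q0 q1].
have q2 : 0 < 1 - q by lra.
rewrite ler_pdivlMr//.
(* Telescoping gives this sharper bound, which induction on [N] preserves; [maxn] covers the [N]
   below the cutoff. *)
suff: (\sum_(0 <= n < N) (M <= n)%:R * q ^+ n) * (1 - q) <=
    q ^+ M - q ^+ maxn M N.
  move/le_trans; apply; rewrite gerBl exprn_ge0//.
elim: N => [|N IH]; first by rewrite big_nil mul0r maxn0 subrr.
rewrite big_nat_recr//= mulrDl (le_trans (lerD IH (lexx _)))//.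
case: leqP => MN.
  have -> : maxn M N.+1 = N.+1 by apply/maxn_idPr; lia.
  by rewrite mulr1n mul1r exprS; lra.
have -> : maxn M N.+1 = M by apply/maxn_idPl; lia.
by rewrite mulr0n !mul0r; lra.
Qed.

Lemma exists_small_expr (q e : R) : 0 <= q < 1 -> 0 < e ->
  exists M, q ^+ M <= e.
Proof.
move=> /andP[q0 q1] e0.
have /cvgrPdist_le/(_ _ e0)[M _ /(_ M (leqnn _))] : GRing.exp q @ \oo --> (0 : R).
  by apply: cvg_expr; rewrite ger0_norm.
by rewrite sub0r normrN ger0_norm ?exprn_ge0// => ?; exists M.
Qed.

(** Markov's inequality for words: tilting [p] by [expR (l * (g i - e))] makes words of large
    [g]-sum cost at least their weight, while level [n] costs [q ^+ n] with [q < 1]. Dropping the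
    levels below [M] brings the total down to [d]. *)
Lemma deviation_cost_at (g : 'I_3 -> R) (e d : R) :
  \sum_i p i * g i = 0 -> 0 < e -> 0 < d ->
  exists c : seq 'I_3 -> \bar R, [/\ forall w, (0 <= c w)%E,
    (total_cost c [::] <= d%:E)%E &
    exists M, forall w, (M <= size w)%N ->
      e * (size w)%:R <= \sum_(i <- w) g i -> ((weight p w)%:E <= c w)%E].
Proof.
move=> g0 e0 d0; have [l l0 lt1] := chernoff_rate g0 e0.
pose f i := p i * expR (l * (g i - e)).
set q := \sum_i _ in lt1.
have f0 i : 0 <= f i by rewrite mulr_ge0// expR_ge0.
have q01 : 0 <= q < 1 by rewrite lt1 andbT; apply: sumr_ge0 => i _; exact: f0.
have dq : 0 < d * (1 - q) by rewrite mulr_gt0// subr_gt0.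
have [M qM] := exists_small_expr q01 dq.
exists (fun w => ((M <= size w)%:R)%:E * (weight f w)%:E)%E; split.
- by move=> w; rewrite mule_ge0// lee_fin// weight_ge0.
- have fE n : level_sum (fun w => ((M <= size w)%:R)%:E * (weight f w)%:E)%E n [::] =
      ((M <= n)%:R * q ^+ n)%:E.
    rewrite (@eq_level_sum _ _ (fun w => ((M <= n)%:R)%:E * (weight f w)%:E)%E).
      rewrite level_sumZ; last by move=> w; rewrite lee_fin weight_ge0.
      by rewrite level_sum_weight /weight big_nil mul1r EFinM.
    by move=> w ->; rewrite add0n.
  rewrite /total_cost; apply: nneseries_le_bound => [n|N].
    rewrite fE lee_fin mulr_ge0// exprn_ge0//; by case/andP: q01.
  under eq_bigr do rewrite fE.
  rewrite sumEFin lee_fin (le_trans (geometric_tail_le _ _ q01))//.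
  by rewrite ler_pdivrMr//; lra.
- exists M => w Mw eg; rewrite Mw mul1e lee_fin weight_expR.
  rewrite ler_peMr ?weight_ge0//.
  apply: le_trans (expR_ge1Dx _); rewrite lerDl mulr_ge0 ?subr_ge0//; exact: ltW.
Qed.

(** One cost serves every [e]: the costs for the thresholds [1 / (m + 1)] are added, with totals at
    most [d / 2 ^ (m + 1)]. *)
Lemma deviation_cost (g : 'I_3 -> R) (d : R) :
  \sum_i p i * g i = 0 -> 0 < d ->
  exists c : seq 'I_3 -> \bar R, [/\ forall w, (0 <= c w)%E,
    (total_cost c [::] <= d%:E)%E &
    forall e, 0 < e -> exists M, forall w, (M <= size w)%N ->
      e * (size w)%:R <= \sum_(i <- w) g i -> ((weight p w)%:E <= c w)%E].
Proof.
move=> g0 d0.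
have d20 m : 0 < d / (2 ^ m.+1)%:R by rewrite divr_gt0// ltr0n expn_gt0.
have /choice[c cP] : forall m, exists c : seq 'I_3 -> \bar R,
    [/\ forall w, (0 <= c w)%E,
    (total_cost c [::] <= (d / (2 ^ m.+1)%:R)%:E)%E &
    exists M, forall w, (M <= size w)%N ->
      m.+1%:R^-1 * (size w)%:R <= \sum_(i <- w) g i -> ((weight p w)%:E <= c w)%E].
  by move=> m; apply: deviation_cost_at.
have c0 m w : (0 <= c m w)%E by case: (cP m).
exists (fun w => \sum_(m <oo) c m w)%E; split.
- by move=> w; apply: nneseries_ge0.
- rewrite total_cost_nneseries//.
  apply: le_trans (epsilon_trick0 xpredT (ltW d0)).
  apply: lee_nneseries; first by move=> *; exact: total_cost_ge0.
  by move=> m _; case: (cP m).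
- move=> e e0; have [m _ /(_ m (leqnn m)) me] := near_infty_natSinv_lt (PosNum e0).
  have [_ _ [M MP]] := cP m.
  exists M => w Mw ew; apply: le_trans (@nneseries_ge_term _ (c ^~ w) m _) => //.
  apply: MP => //; apply: le_trans ew.
  by rewrite ler_wpM2r// ltW.
Qed.

End deviations.

(** * Ternary expansions and cylinders *)

Section ternary_expansions.
Context {R : realType}.
Implicit Types (x : R) (al be : nat -> 'I_3) (w : seq 'I_3).

Definition word_val w : nat := foldl (fun v (i : 'I_3) => 3 * v + i)%N 0%N w.

Lemma word_val_rcons w i : word_val (rcons w i) = (3 * word_val w + i)%N.
Proof. by rewrite /word_val foldl_rcons. Qed.

Lemma natr_word_val_rcons w i :
  (word_val (rcons w i))%:R = 3 * (word_val w)%:R + i%:R :> R.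
Proof. by rewrite word_val_rcons natrD natrM. Qed.

(** Both ends are included, so that a point with two expansions lies in the cylinders of both. *)
Definition in_cylinder w x :=
  (word_val w)%:R <= x * 3 ^+ size w <= (word_val w)%:R + 1.

Lemma in_cylinder_nil x : in_cylinder [::] x = (0 <= x <= 1).
Proof. by rewrite /in_cylinder /= expr0 mulr1 add0r. Qed.

Lemma series_word_val al n :
  series (fun k => (al k)%:R / 3 ^+ k.+1 : R) n =
  (word_val (mkseq al n))%:R / 3 ^+ n.
Proof.
rewrite /series/=; elim: n => [|n IH]; first by rewrite big_nil mul0r.
rewrite big_nat_recr//= IH mkseqS natr_word_val_rcons exprS.
by field; rewrite expf_neq0.
Qed.

Lemma in_cylinder_mkseq al m n x : (m <= n)%N ->
  in_cylinder (mkseq al n) x -> in_cylinder (mkseq al m) x.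
Proof.
elim: n => [|n IH]; first by rewrite leqn0 => /eqP ->.
rewrite leq_eqVlt => /predU1P[->//|]; rewrite ltnS => /IH mn xn; apply: mn.
move: xn; rewrite /in_cylinder mkseqS natr_word_val_rcons !size_rcons !size_mkseq.
rewrite exprS.
have : (al n)%:R <= 2 :> R by rewrite ler_nat -ltnS.
have : 0 <= (al n)%:R :> R by [].
by move=> ? ? /andP[? ?]; apply/andP; split; lra.
Qed.

(** Later partial sums stay in the closed cylinder of a prefix, hence so does the limit; conversely,
    the cylinder of [n] digits has length [1 / 3 ^+ n], which tends to 0. *)
Lemma ternary_expansionP x al :
  ternary_expansion x al <-> forall n, in_cylinder (mkseq al n) x.
Proof.
have p3 n : 0 < 3 ^+ n :> R by rewrite exprn_gt0.
rewrite /ternary_expansion; split => [alx n|alx].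
  pose y := (word_val (mkseq al n))%:R / 3 ^+ n : R.
  have below m : (n <= m)%N -> in_cylinder (mkseq al n)
      (series (fun k => (al k)%:R / 3 ^+ k.+1 : R) m).
    move=> /in_cylinder_mkseq; apply.
    by rewrite series_word_val /in_cylinder size_mkseq divfK ?gt_eqF// lexx lerDl/=.
  rewrite /in_cylinder size_mkseq -(ler_pdivrMr _ _ (p3 n)) -(ler_pdivlMr _ _ (p3 n)).
  have bnd m : (n <= m)%N -> y <= series (fun k => (al k)%:R / 3 ^+ k.+1 : R) m
       <= ((word_val (mkseq al n))%:R + 1) / 3 ^+ n.
    move=> /below; rewrite /in_cylinder size_mkseq /y ler_pdivrMr//.
    by rewrite ler_pdivlMr.
  apply/andP; split.
    by apply: (cvgr_to_ge alx); exists n => // m /bnd /andP[].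
  by apply: (cvgr_to_le alx); exists n => // m /bnd /andP[].
apply/cvgrPdist_le => e e0.
have [M Me] := @exists_small_expr R (1 / 3) e ltac:(lra) e0.
exists M => // n Mn; rewrite /= series_word_val.
have /andP[h1 h2] := alx n; rewrite size_mkseq in h1 h2.
have h3 : `|x - (word_val (mkseq al n))%:R / 3 ^+ n| <= 1 / 3 ^+ n.
  rewrite ler_pdivlMr// -[X in _ * X](gtr0_norm (p3 n)) -normrM mulrBl.
  by rewrite divfK ?gt_eqF// ger0_norm; lra.
apply: le_trans h3 (le_trans _ Me).
rewrite expr_div_n expr1n !div1r lef_pV2 ?posrE//.
by apply: ler_weXn2l => //; rewrite ler1n.
Qed.

Lemma exists_ternary_sum al : exists x, ternary_expansion x al.
Proof.
have p3 n : 0 < 3 ^+ n :> R by rewrite exprn_gt0.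
exists (limn (series (fun k => (al k)%:R / 3 ^+ k.+1 : R))).
apply: nondecreasing_is_cvgn.
  by apply: nondecreasing_series => n _ _; rewrite divr_ge0// ltW.
exists 1 => _ [n _ <-].
have : in_cylinder (mkseq al n) (series (fun k => (al k)%:R / 3 ^+ k.+1 : R) n).
  by rewrite series_word_val /in_cylinder size_mkseq divfK ?gt_eqF// lexx lerDl/=.
by move=> /(in_cylinder_mkseq (leq0n n)); rewrite in_cylinder_nil => /andP[].
Qed.

Lemma ternary_expansion_itv x al : ternary_expansion x al -> 0 <= x <= 1.
Proof. by move=> /ternary_expansionP/(_ 0%N); rewrite in_cylinder_nil. Qed.

Lemma exists_ternary_expansion x : 0 <= x <= 1 -> exists al, ternary_expansion x al.
Proof.
move=> x01.
(* Ties go to the lower digit, so the resulting expansion may end in 2s. Below, [r n] is the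
   fractional remainder of [x * 3 ^+ n]. *)
pose dig (r : R) : 'I_3 := inord (if r <= 1 / 3 then 0 else if r <= 2 / 3 then 1 else 2).
pose r := fix r n := if n is n'.+1 then 3 * r n' - (dig (r n'))%:R else x.
have r01 n : 0 <= r n <= 1.
  elim: n => [//|n /andP[r0 r1] /=]; rewrite /dig.
  have [r2|r2] := leP (r n) (1 / 3); first by rewrite inordK//; lra.
  by have [r3|r3] := leP (r n) (2 / 3); rewrite inordK//; lra.
have rE n : x * 3 ^+ n = (word_val (mkseq (fun k => dig (r k)) n))%:R + r n.
  elim: n => [|n IH]; first by rewrite expr0 mulr1 add0r.
  by rewrite exprSr mulrA IH mkseqS natr_word_val_rcons/=; ring.
exists (fun k => dig (r k)); apply/ternary_expansionP => n.
rewrite /in_cylinder size_mkseq rE; have := r01 n; lra.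
Qed.

Lemma canonical_ternary_digit x : 0 <= x <= 1 ->
  canonical_expansion x (ternary_digit x).
Proof.
move=> x01; rewrite /ternary_digit; case: xgetP => [al _ //|noal].
have [al alx] := exists_ternary_expansion x01.
case: (pselect (exists be, ternary_expansion x be /\ ends_in_zeros be)).
  by move=> [be [bex be0]]; case: (noal be); split.
by move=> nobe; case: (noal al); split.
Qed.

(** After the first difference both cylinders contain [x], so they are neighbours and [x] is the
    right end of one and the left end of the other. This persists at all later levels and forces the
    digits. *)
Lemma ternary_expansion_adjacent x al be :
  ternary_expansion x al -> ternary_expansion x be -> al <> be ->
  exists n, ((forall m, n < m -> al m = ord_max /\ be m = ord0) \/
             (forall m, n < m -> be m = ord_max /\ al m = ord0))%N.
Proof.
move=> /ternary_expansionP alx /ternary_expansionP bex albe.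
have [n nP] : exists n, al n != be n.
  apply: contrapT => /forallNP allE; apply: albe; apply/funext => n.
  by have /negP/negPn/eqP := allE n.
have ex : exists n, al n != be n by exists n.
have aux al' be' : (forall n, in_cylinder (mkseq al' n) x) ->
    (forall n, in_cylinder (mkseq be' n) x) ->
    mkseq al' (ex_minn ex) = mkseq be' (ex_minn ex) ->
    (al' (ex_minn ex) < be' (ex_minn ex))%N ->
    (forall m, ex_minn ex < m -> al' m = ord_max /\ be' m = ord0)%N.
  set k := ex_minn ex; move=> al'x be'x E lt.
  have three_le (y : nat) : (y%:R : R) <= 2 -> (y <= 2)%N by rewrite ler_nat.
  have tight m : (k < m)%N ->
     x * 3 ^+ m = (word_val (mkseq al' m))%:R + 1 /\
     x * 3 ^+ m = (word_val (mkseq be' m))%:R.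
    elim: m => // m IH; rewrite ltnS leq_eqVlt => /predU1P[mk|/IH[E1 E2]];
      have := al'x m.+1; have := be'x m.+1; rewrite /in_cylinder !size_mkseq;
      rewrite !mkseqS !natr_word_val_rcons.
      rewrite -mk E.
      have : (al' k)%:R + 1 <= (be' k)%:R :> R by rewrite natr1 ler_nat.
      by move=> ? /andP[? ?] /andP[? ?]; split; lra.
    have : (al' m)%:R <= 2 :> R by rewrite ler_nat -ltnS.
    have : 0 <= (be' m)%:R :> R by [].
    by rewrite exprSr mulrA => ? ? /andP[? ?] /andP[? ?]; split; lra.
  move=> m km; have [E1 E2] := tight m km.
  have [] := tight m.+1 (leqW km).
  rewrite !mkseqS !natr_word_val_rcons exprSr mulrA => E3 E4.
  have a2 : (al' m)%:R = 2%:R :> R by lra.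
  have b0 : (be' m)%:R = 0%:R :> R by lra.
  by split; apply/val_inj => /=; [apply/eqP; rewrite -(eqr_nat R) a2|
    apply/eqP; rewrite -(eqr_nat R) b0].
have pre : mkseq al (ex_minn ex) = mkseq be (ex_minn ex).
  case: ex_minnP => k _ kmin; apply/eq_in_map => i; rewrite mem_iota add0n /=.
  by move=> ik; apply/eqP; apply: contraTT ik => /kmin; rewrite -leqNgt.
have ne : al (ex_minn ex) != be (ex_minn ex) by case: ex_minnP.
exists (ex_minn ex); case: (ltngtP (al (ex_minn ex)) (be (ex_minn ex))).
- by move=> lt; left; exact: aux.
- by move=> lt; right; exact: aux.
- by move=> /val_inj E; rewrite E eqxx in ne.
Qed.

(** If the chosen digits differed from [al], one sequence would end in 2s and the other in 0s.
    Canonicity forbids the chosen one to end in 2s, the hypothesis forbids it for [al]. *)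
Lemma ternary_digitE x al : ternary_expansion x al ->
  (forall m, exists2 n, (m <= n)%N & al n != ord_max) -> ternary_digit x = al.
Proof.
move=> alx al2; apply: contrapT => ne.
have [bex becan] := canonical_ternary_digit (ternary_expansion_itv alx).
have [n [nP|nP]] := ternary_expansion_adjacent bex alx ne.
  have [|k kP] := becan; last first.
    have [] := nP (maxn n.+1 k) (leq_maxl _ _).
    by rewrite kP ?leq_maxr.
  by exists al; split => //; exists n.+1 => m /nP[].
by have [m nm] := al2 n.+1; have [-> _] := nP _ nm; rewrite eqxx.
Qed.

End ternary_expansions.

(** * Digit frequencies and the mean *)

Section digit_frequencies.
Context {R : realType}.
Implicit Types (x : R) (al : nat -> 'I_3).

Definition digit_freq al (i : nat) : R^nat :=
  fun n => (count (fun d : 'I_3 => d == i :> nat) (mkseq al n))%:R / n%:R.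

Lemma count_mkseqS (P : pred 'I_3) al n :
  count P (mkseq al n.+1) = (count P (mkseq al n) + P (al n))%N.
Proof. by rewrite mkseqS -cats1 count_cat /= addn0. Qed.

Lemma rel_freqE x i : rel_freq i x = digit_freq (ternary_digit x) i.
Proof.
apply/funext => n; rewrite /rel_freq /digit_freq; congr (_%:R / _).
rewrite /digit_count cardsE -sum1_card big_mkcond /=.
elim: n => [|n IH]; first by rewrite big_ord0.
by rewrite big_ord_recr count_mkseqS -IH /=; congr (_ + _)%N; case: eqP.
Qed.

Lemma digit_meanE x n : digit_mean x n =
  digit_freq (ternary_digit x) 1 n + 2 * digit_freq (ternary_digit x) 2 n.
Proof.
rewrite /digit_mean /digit_freq mulrA -mulrDl mulrC; congr (_ / _).
elim: n => [|n IH]; first by rewrite big_ord0 /= mulr0 addr0.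
rewrite !count_mkseqS !natrD big_ord_recr [LHS]/= IH.
by case: (ternary_digit x n) => [[|[|[|]]]] //= _; lra.
Qed.

Lemma Kset_of_freqs x al (nu1 nu2 : R) : ternary_expansion x al ->
  (forall m, exists2 n, (m <= n)%N & al n != ord_max) ->
  digit_freq al 1 @ \oo --> nu1 -> digit_freq al 2 @ \oo --> nu2 ->
  Kset (nu1 + 2 * nu2) x.
Proof.
move=> alx al2 f1 f2; have E := ternary_digitE alx al2; split.
- by rewrite in_itv/=; exact: ternary_expansion_itv alx.
- under eq_cvg do rewrite digit_meanE.
  by rewrite E; apply: cvgD => //; apply: cvgMr.
- by rewrite rel_freqE E; apply: cvgP f1.
- by rewrite rel_freqE E; apply: cvgP f2.
Qed.

End digit_frequencies.

(** * A sequence of mean [a] with free digits at the squares *)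

Section sparse_family.
Context {R : realType}.

(* [ceil_sqrt n] counts the squares below [n]. *)
Fixpoint ceil_sqrt (n : nat) : nat :=
  if n is n'.+1 then
    let r := ceil_sqrt n' in if (r ^ 2 == n')%N then r.+1 else r
  else 0%N.

Lemma ceil_sqrt_bounds n :
  (n <= ceil_sqrt n ^ 2)%N /\ (ceil_sqrt n = 0 \/ (ceil_sqrt n).-1 ^ 2 < n)%N.
Proof.
elim: n => [|n [h1 h2]] /=; first by split; [|left].
by case: eqP => [E|NE]; split; try (right; simpl; nia); nia.
Qed.

Lemma ceil_sqrt_sqr k : ceil_sqrt (k ^ 2) = k.
Proof. have [h1 [h2|h2]] := ceil_sqrt_bounds (k ^ 2); nia. Qed.

Lemma ceil_sqrt_small (K : nat) (e : R) : 0 < e ->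
  \forall n \near \oo, (ceil_sqrt n + K)%:R <= e * n%:R.
Proof.
move=> e0.
have e20 : 0 < e ^+ 2 by rewrite exprn_gt0.
near=> n.
(* If the claim fails, [n2] makes [ceil_sqrt n - 1] exceed [e * n / 2]; since its square is below
   [n], this contradicts [n1]. *)
have n1 : 4 <= e ^+ 2 * n%:R.
  rewrite mulrC -ler_pdivrMr//; near: n; exact: nbhs_infty_ger.
have n2 : 2 * (K.+1)%:R <= e * n%:R.
  rewrite [leRHS]mulrC -ler_pdivrMr//; near: n; exact: nbhs_infty_ger.
rewrite leNgt; apply/negP => lt.
have n0 : 0 <= n%:R :> R by [].
have K0 : 0 <= K%:R :> R by [].
rewrite -natr1 in n2.
have [_ [E|]] := ceil_sqrt_bounds n; first by rewrite E add0n in lt; lra.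
case: (ceil_sqrt n) lt => [|r] /=; first by rewrite add0n; lra.
rewrite addSnnS natrD -natr1 => lt; rewrite -(ltr_nat R) natrX => rn.
have h : e * n%:R / 2 < r%:R by lra.
have h2 : (e * n%:R / 2) ^+ 2 < r%:R ^+ 2.
  by rewrite ltrXn2r// ?nnegrE// divr_ge0// mulr_ge0// ltW.
have : (e * n%:R / 2) ^+ 2 = (e ^+ 2 * n%:R) * n%:R / 4 by field.
by move=> E; nra.
Unshelve. all: by end_near. Qed.

Variables (a : R) (pre : nat -> 'I_3) (n0 : nat) (b : nat -> bool).
Hypothesis ha : 0 <= a <= 2.

(** By [two_count_bounds] this is the integer part of [n * (a / 2)]; steps of at most one suffice
    because [a / 2 <= 1]. *)
Fixpoint two_count (n : nat) : nat :=
  if n is n'.+1 then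
    (two_count n' + ((two_count n').+1%:R <= n%:R * (a / 2))%R)%N
  else 0%N.

(** Squares have density 0, so the bits placed there leave the frequencies unchanged; being 0 or 1,
    they keep the sequence from ending in 2s. *)
Definition sparse_seq (j : nat) : 'I_3 :=
  if (j < n0)%N then pre j
  else if (ceil_sqrt j ^ 2 == j)%N then inord (b (ceil_sqrt j))
  else if (two_count j).+1%:R <= j.+1%:R * (a / 2) then ord_max else ord0.

Lemma two_count_bounds n :
  (two_count n)%:R <= n%:R * (a / 2) < (two_count n)%:R + 1.
Proof.
case/andP: ha => a0 a2.
elim: n => [|n /andP[h1 h2]]; first by rewrite mul0r lexx add0r ltr01.
have -> : two_count n.+1 =
  (two_count n + ((two_count n).+1%:R <= n.+1%:R * (a / 2))%R)%N by [].
case: (leP (two_count n).+1%:R) => h; rewrite natrD ?mulr1n ?mulr0n -[n.+1%:R]natr1;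
  by rewrite -[n.+1%:R]natr1 -[(two_count n).+1%:R]natr1 in h; apply/andP; split; lra.
Qed.

Lemma sparse_seq_count1 n :
  (count (fun d : 'I_3 => d == 1 :> nat) (mkseq sparse_seq n) <=
   ceil_sqrt n + minn n n0)%N.
Proof.
elim: n => // n IH; rewrite count_mkseqS; set c := count _ _ in IH *.
rewrite /= /sparse_seq.
case: ltnP => nn0; first by case: (_ == 1%N); case: ifP => _; lia.
case: ifP => _; first by case: (_ == 1%N); lia.
by case: ifP => _ /=; lia.
Qed.

(** [two_count] also runs over prefix and square positions, so it differs from the actual number of
    2s by at most the number of such positions. *)
Lemma sparse_seq_count2 n :
  (count (fun d : 'I_3 => d == 2 :> nat) (mkseq sparse_seq n) <=
     two_count n + minn n n0 /\
   two_count n <= count (fun d : 'I_3 => d == 2 :> nat) (mkseq sparse_seq n) +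
     ceil_sqrt n + minn n n0)%N.
Proof.
elim: n => // n [IH1 IH2]; rewrite count_mkseqS; set c := count _ _ in IH1 IH2 *.
rewrite /= /sparse_seq.
case: ltnP => nn0.
  by case: (_ == 2%N); case: (_ <= _)%R; case: ifP => _ /=; lia.
case: ifP => sq.
  by rewrite inordK; [case: (b _); case: (_ <= _)%R => /=; lia | case: (b _)].
by case: (_ <= _)%R => /=; lia.
Qed.

Lemma sparse_seq_freq1 : digit_freq sparse_seq 1 @ \oo --> (0 : R).
Proof.
apply/cvgrPdist_le => e e0; near=> n.
rewrite sub0r normrN ger0_norm ?divr_ge0// ler_pdivrMr; last first.
  by rewrite ltr0n; near: n; exact: nbhs_infty_gt.
apply: (@le_trans _ _ (ceil_sqrt n + n0)%:R).
  by rewrite ler_nat (leq_trans (sparse_seq_count1 n))// leq_add2l geq_minr.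
by near: n; exact: ceil_sqrt_small.
Unshelve. all: by end_near. Qed.

Lemma sparse_seq_freq2 : digit_freq sparse_seq 2 @ \oo --> a / 2.
Proof.
apply/cvgrPdist_le => e e0; near=> n.
have npos : 0 < n%:R :> R by rewrite ltr0n; near: n; exact: nbhs_infty_gt.
have small : (ceil_sqrt n + n0.+1)%:R <= e * n%:R.
  by near: n; exact: ceil_sqrt_small.
have [c1 c2] := sparse_seq_count2 n.
have /andP[t1 t2] := two_count_bounds n.
set c := count _ _ in c1 c2 *.
have {}c1 : c%:R <= (two_count n)%:R + n0%:R :> R.
  by rewrite -natrD ler_nat (leq_trans c1)// leq_add2l geq_minr.
have {}c2 : (two_count n)%:R <= c%:R + (ceil_sqrt n)%:R + n0%:R :> R.
  by rewrite -!natrD ler_nat (leq_trans c2)// leq_add2l geq_minr.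
move: small; rewrite natrD -natr1 => small.
have : 0 <= (ceil_sqrt n)%:R :> R by [].
rewrite /digit_freq -/c => r0.
have -> : a / 2 - c%:R / n%:R = (n%:R * (a / 2) - c%:R) / n%:R.
  by rewrite mulrBl mulrAC divff ?gt_eqF// mul1r.
rewrite normrM normfV (gtr0_norm npos) ler_pdivrMr// ler_norml.
by apply/andP; split; lra.
Unshelve. all: by end_near. Qed.

Lemma sparse_seq_sqr k : (n0 <= k)%N -> sparse_seq (k ^ 2) = inord (b k).
Proof.
move=> n0k; rewrite /sparse_seq ceil_sqrt_sqr eqxx ifN// -leqNgt.
by rewrite (leq_trans n0k)//; nia.
Qed.

Lemma sparse_seq_not_max m : exists2 n, (m <= n)%N & sparse_seq n != ord_max.
Proof.
exists (maxn m n0 ^ 2)%N; first by nia.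
rewrite sparse_seq_sqr ?leq_maxr//; apply/eqP => /(congr1 val) /=.
by rewrite inordK; case: (b _).
Qed.

Lemma Kset_sparse_seq x : ternary_expansion x sparse_seq -> Kset a x.
Proof.
move=> ex; have -> : a = 0 + 2 * (a / 2) by lra.
apply: Kset_of_freqs ex sparse_seq_not_max sparse_seq_freq1 sparse_seq_freq2.
Qed.

End sparse_family.

(** * Density and cardinality *)

Section Kset_density_cardinality.
Context {R : realType} (a : R) (ha : 0 <= a <= 2).

Lemma Kset_dense : `[0, 1]%classic `<=` closure (Kset a).
Proof.
move=> x; rewrite /= in_itv/= => x01 B /nbhs_ballP[e /= e0 eB].
have [al /ternary_expansionP alx] := exists_ternary_expansion x01.
have e20 : 0 < e / 2 by lra.
have [n ne] := @exists_small_expr R (1 / 3) (e / 2) ltac:(lra) e20.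
(* [y] shares the first [n] digits of [x], hence a cylinder of length at most [e / 2]. *)
have [y yE] := @exists_ternary_sum R (sparse_seq a al n (fun=> true)).
exists y; split; first exact: Kset_sparse_seq yE.
apply: eB; rewrite /ball /= .
have /ternary_expansionP/(_ n) := yE; have := alx n.
have -> : mkseq (sparse_seq a al n (fun=> true)) n = mkseq al n.
  by apply/eq_in_map => i; rewrite mem_iota add0n /sparse_seq => /= ->.
rewrite /in_cylinder size_mkseq; set v := _%:R => /andP[? ?] /andP[? ?].
have p3 : 0 < 3 ^+ n :> R by rewrite exprn_gt0.
have -> : x - y = (x * 3 ^+ n - y * 3 ^+ n) / 3 ^+ n.
  by rewrite -mulrBl mulfK// gt_eqF.
move: ne; rewrite expr_div_n expr1n ler_pdivrMr// => ne.
rewrite normrM normfV (gtr0_norm p3) ltr_pdivrMr//.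
by apply: (@le_lt_trans _ _ 1); [rewrite ler_norml|]; nra.
Qed.

Lemma Kset_continuum : (Kset a #= [set: R])%card.
Proof.
rewrite card_eq_le card_leT /=.
(* The bits encode the Dedekind cut of [y]; a rational between two reals separates their codes. *)
pose b (y : R) k := if unpickle k is Some q then ratr q < y else false.
have /choice[f fP] (y : R) :
    exists x : R, ternary_expansion x (sparse_seq a (fun=> ord0) 0 (b y)).
  exact: exists_ternary_sum.
have fK y : Kset a (f y) by exact: Kset_sparse_seq (fP y).
have digE u : ternary_digit (f u) = sparse_seq a (fun=> ord0) 0 (b u).
  by apply: ternary_digitE (fP u) _; exact: sparse_seq_not_max.
have finj : injective f.
  move=> y z fyz.
  have E : sparse_seq a (fun=> ord0) 0 (b y) = sparse_seq a (fun=> ord0) 0 (b z).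
    by rewrite -!digE fyz.
  have bE q : (ratr q < y) = (ratr q < z).
    have := congr1 (fun s : nat -> 'I_3 => s (pickle q ^ 2)%N : nat) E.
    rewrite !sparse_seq_sqr// /b pickleK.
    by case: (ratr q < y); case: (ratr q < z) => //; rewrite !inordK.
  case: (ltgtP y z) => // lt; have [q] := rat_in_itvoo lt; rewrite in_itv/=.
    by rewrite -bE => /andP[/lt_trans h /h]; rewrite ltxx.
  by rewrite bE => /andP[/lt_trans h /h]; rewrite ltxx.
apply/pcard_leP/injfunPex; exists f => [y _|y z _ _]; [exact: fK|exact: finj].
Qed.

End Kset_density_cardinality.

(** * Costs that control digit frequencies *)

Lemma freq_lt1_not_max {R : realType} (al : nat -> 'I_3) (nu : R) :
  digit_freq al 2 @ \oo --> nu -> nu < 1 ->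
  forall m, exists2 n, (m <= n)%N & al n != ord_max.
Proof.
move=> f nu1 m; apply: contrapT => no.
have al2 n : (m <= n)%N -> al n = ord_max.
  by move=> mn; apply/eqP/negPn/negP => aln; apply: no; exists n.
(* With only 2s from position [m] on, the frequency of 2 would be 1, contrary to [nu < 1]. *)
have cnt n : (n <= count (fun d : 'I_3 => d == 2 :> nat) (mkseq al n) + m)%N.
  elim: n => // n; rewrite count_mkseqS; set k := count _ _ => IH.
  by have [/al2 ->|nm] := leqP m n => /=; lia.
suff f1 : digit_freq al 2 @ \oo --> (1 : R).
  have E : nu = 1 by exact: cvg_unique f f1.
  by move: nu1; rewrite E ltxx.
apply/cvgrPdist_le => e e0; near=> n.
have npos : 0 < n%:R :> R by rewrite ltr0n; near: n; exact: nbhs_infty_gt.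
have mn : m%:R <= e * n%:R.
  by rewrite mulrC -ler_pdivrMr//; near: n; exact: nbhs_infty_ger.
have : n%:R <= (count (fun d : 'I_3 => d == 2 :> nat) (mkseq al n))%:R + m%:R :> R.
  by rewrite -natrD ler_nat.
have : (count (fun d : 'I_3 => d == 2 :> nat) (mkseq al n))%:R <= n%:R :> R.
  by rewrite ler_nat -[leqRHS](size_mkseq al) count_size.
rewrite /digit_freq; move: (count _ _)%:R => k kn nk.
have -> : 1 - k / n%:R = (n%:R - k) / n%:R by rewrite mulrBl divff// gt_eqF.
rewrite normrM normfV (gtr0_norm npos) ler_pdivrMr// ler_norml.
by apply/andP; split; lra.
Unshelve. all: by end_near. Qed.

Section frequency_costs.
Context {R : realType}.
Variable p : 'I_3 -> R.
Hypothesis p_ge0 : forall i, 0 <= p i.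
Hypothesis sum_p : \sum_i p i = 1.

Lemma sum_indicator (i : nat) (nu : R) (w : seq 'I_3) :
  \sum_(d <- w) ((d == i :> nat)%:R - nu) =
  (count (fun d : 'I_3 => d == i :> nat) w)%:R - nu * (size w)%:R.
Proof.
elim: w => [|d w IH]; first by rewrite big_nil mulr0 subrr.
by rewrite big_cons IH /= -natr1 natrD; ring.
Qed.

Lemma indicator_centered (i : 'I_3) :
  \sum_d p d * ((d == i :> nat)%:R - p i) = 0.
Proof.
under eq_bigr do rewrite mulrBr.
rewrite sumrB -mulr_suml sum_p mul1r (bigD1 i)//= eqxx mulr1 big1 ?addr0 ?subrr//.
by move=> d /negPf; rewrite -val_eqE /= => ->; rewrite mulr0.
Qed.

(** Penalizing the centered indicator of [i] and its opposite bounds the frequency from both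
    sides. *)
Lemma frequency_cost (i : 'I_3) (d : R) : 0 < d ->
  exists c : seq 'I_3 -> \bar R, [/\ forall w, (0 <= c w)%E,
    (total_cost c [::] <= d%:E)%E &
    forall al, (forall n, c (mkseq al n) < (weight p (mkseq al n))%:E)%E ->
      digit_freq al i @ \oo --> p i].
Proof.
move=> d0; have d20 : 0 < d / 2 by lra.
have g0 := indicator_centered i.
have h0 : \sum_d p d * - ((d == i :> nat)%:R - p i) = 0.
  by under eq_bigr do rewrite mulrN; rewrite sumrN g0 oppr0.
have [c1 [c10 tot1 dev1]] := deviation_cost p_ge0 sum_p g0 d20.
have [c2 [c20 tot2 dev2]] := deviation_cost p_ge0 sum_p h0 d20.
exists (fun w => c1 w + c2 w)%E; split.
- by move=> w; rewrite adde_ge0.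
- by rewrite total_costD// [d]splitr EFinD leeD.
move=> al alP; apply/cvgrPdist_le => e e0.
have [M1 M1P] := dev1 e e0; have [M2 M2P] := dev2 e e0.
exists (maxn 1 (maxn M1 M2)) => // n; rewrite /= !geq_max => /and3P[n1 nM1 nM2].
have npos : 0 < n%:R :> R by rewrite ltr0n.
have lt1 : \sum_(d <- mkseq al n) ((d == i :> nat)%:R - p i) < e * n%:R.
  rewrite ltNge; apply/negP => h; have := M1P (mkseq al n).
  rewrite size_mkseq => /(_ nM1 h); apply/negP; rewrite -ltNge.
  apply: le_lt_trans (alP n).
  by rewrite leeDl.
have lt2 : \sum_(d <- mkseq al n) - ((d == i :> nat)%:R - p i) < e * n%:R.
  rewrite ltNge; apply/negP => h; have := M2P (mkseq al n).
  rewrite size_mkseq => /(_ nM2 h); apply/negP; rewrite -ltNge.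
  apply: le_lt_trans (alP n).
  by rewrite leeDr.
move: lt1 lt2; rewrite sumrN sum_indicator size_mkseq => lt1 lt2.
rewrite /digit_freq; set k := _%:R in lt1 lt2 *.
have -> : p i - k / n%:R = (p i * n%:R - k) / n%:R.
  by rewrite mulrBl mulfK// gt_eqF.
rewrite normrM normfV (gtr0_norm npos) ler_pdivrMr// ler_norml.
by apply/andP; split; lra.
Qed.

Lemma frequencies_cost (d : R) : 0 < d ->
  exists c : seq 'I_3 -> \bar R, [/\ forall w, (0 <= c w)%E,
    (total_cost c [::] <= d%:E)%E &
    forall al, (forall n, c (mkseq al n) < (weight p (mkseq al n))%:E)%E ->
      digit_freq al 1 @ \oo --> p (Ordinal (isT : 1 < 3)%N) /\
      digit_freq al 2 @ \oo --> p ord_max].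
Proof.
move=> d0; have d20 : 0 < d / 2 by lra.
have [c1 [c10 tot1 dev1]] := frequency_cost (Ordinal (isT : 1 < 3)%N) d20.
have [c2 [c20 tot2 dev2]] := frequency_cost ord_max d20.
exists (fun w => c1 w + c2 w)%E; split.
- by move=> w; rewrite adde_ge0.
- by rewrite total_costD// [d]splitr EFinD leeD.
move=> al alP; split.
  by apply: dev1 => n; apply: le_lt_trans (alP n); rewrite leeDl.
by apply: dev2 => n; apply: le_lt_trans (alP n); rewrite leeDr.
Qed.

End frequency_costs.

(** * Lebesgue measure *)

Section lebesgue_size.
Context {R : realType}.

Definition simply_normal (x : R) : Prop :=
  digit_freq (ternary_digit x) 1 @ \oo --> (1 / 3 : R) /\
  digit_freq (ternary_digit x) 2 @ \oo --> (1 / 3 : R).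

Definition abnormal_set : set R := [set x : R | 0 <= x <= 1 /\ ~ simply_normal x].

Local Open Scope ereal_scope.
Implicit Types (A N : set R) (c : seq 'I_3 -> \bar R).

Local Notation outer := ((wlength (@idfun R))^*%mu).

Lemma outer_null_measurable N : outer N = 0 -> lebesgue_measurable N.
Proof.
move=> N0; apply: le_caratheodory_measurable => /= X.
apply: (@le_trans _ _ (outer N + outer (X `&` ~` N))).
  by rewrite leeD2r// le_outer_measure//; exact: subIsetr.
by rewrite N0 add0e le_outer_measure//; exact: subIsetl.
Qed.

Lemma outer_in_cylinder (w : seq 'I_3) :
  outer [set x | in_cylinder w x] = ((1 / 3) ^+ size w)%:E.
Proof.
have p3 : (0 < 3 ^+ size w :> R)%R by rewrite exprn_gt0.
pose I : interval R :=
  `[(word_val w)%:R / 3 ^+ size w, ((word_val w)%:R + 1) / 3 ^+ size w]%R.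
have -> : ([set x | in_cylinder w x] : set R) = [set` I].
  apply/seteqP; split => x; rewrite /= in_itv/= /in_cylinder.
    by rewrite ler_pdivrMr// ler_pdivlMr.
  by rewrite ler_pdivrMr// ler_pdivlMr.
rewrite -[LHS]/(lebesgue_measure [set` I]) lebesgue_measure_itv /= lte_fin.
rewrite ltr_pM2r ?invr_gt0// ltrDl ltr01.
by rewrite -EFinB -mulrBl addrC addKr expr_div_n expr1n.
Qed.

(** The recursion mirrors [level_sum], so that subadditivity bounds the outer measure by the cost;
    [(1 / 3) ^+ size u] is both the length of the cylinder and the uniform weight of [u]. *)
Fixpoint costly_set c (n : nat) (u : seq 'I_3) : set R :=
  if n is n'.+1 then \big[setU/set0]_(i < 3) costly_set c n' (rcons u i)
  else if ((1 / 3) ^+ size u)%:E <= c u then [set x | in_cylinder u x] else set0.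

Lemma outer_costly_set c n u : (forall w, 0 <= c w) ->
  outer (costly_set c n u) <= level_sum c n u.
Proof.
move=> c0; elim: n u => [|n IH] u /=.
  by case: ifPn => [cu|_]; rewrite ?outer_in_cylinder ?outer_measure0.
rewrite !big_ord_recr !big_ord0 /= set0U add0e.
apply: le_trans (outer_measureU2 _ _ _) _; apply: leeD; last exact: IH.
by apply: le_trans (outer_measureU2 _ _ _) _; apply: leeD; exact: IH.
Qed.

Lemma mem_costly_set c u w x : in_cylinder (u ++ w) x ->
  ((1 / 3) ^+ size (u ++ w))%:E <= c (u ++ w) -> costly_set c (size w) u x.
Proof.
elim: w u => [|i w IH] u /=; first by rewrite cats0 => xw ->.
rewrite -cat_rcons => xw cw; rewrite (bigD1 i)//=; left; exact: IH.
Qed.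

(** The digits of a point of [0, 1] outside all costly sets have prefixes cheaper than their
    weights, so the point is simply normal. The costly sets have total outer measure at most the
    total cost, which is arbitrarily small. *)
Lemma outer_abnormal_set : outer abnormal_set = 0.
Proof.
apply/eqP; rewrite eq_le outer_measure_ge0 andbT.
apply/lee_addgt0Pr => d d0; rewrite add0e.
have p1 : (\sum_(i < 3) (1 / 3 : R) = 1)%R.
  by rewrite !big_ord_recr big_ord0 /=; lra.
have p0 (i : 'I_3) : (0 <= 1 / 3 :> R)%R by lra.
have [c [c0 tot cP]] := frequencies_cost p0 p1 d0.
apply: (@le_trans _ _ (outer (\bigcup_n costly_set c n [::]))).
  apply: le_outer_measure => x [x01 abn].
  apply: contrapT => notin; apply: abn; apply: cP => n.
  have -> : weight (fun=> 1 / 3)%R (mkseq (ternary_digit x) n) =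
      ((1 / 3) ^+ n)%R :> R.
    by rewrite /weight big_const_seq count_predT size_mkseq -Monoid.iteropE.
  rewrite ltNge; apply/negP => cn; apply: notin; exists n => //.
  have := @mem_costly_set c [::] (mkseq (ternary_digit x) n) x.
  rewrite /= size_mkseq; apply => //.
  by have [/ternary_expansionP] := canonical_ternary_digit x01.
apply: le_trans (outer_measure_sigma_subadditive _ _) _.
apply: le_trans tot; apply: lee_nneseries => [n _ _|n _].
  exact: outer_measure_ge0.
exact: outer_costly_set.
Qed.

Lemma Kset_lebesgue (a : R) : lebesgue_measurable (Kset a) /\
  completed_lebesgue_measure (Kset a) = if a == 1%R then 1 else 0.
Proof.
rewrite -[completed_lebesgue_measure _]/(outer (Kset a)).
have sub_null A : A `<=` abnormal_set -> outer A = 0.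
  move=> AN; apply/eqP; rewrite eq_le outer_measure_ge0 andbT.
  by rewrite -outer_abnormal_set le_outer_measure.
have normal_mean x : simply_normal x -> digit_mean x @ \oo --> (1 : R)%R.
  move=> [f1 f2]; have -> : (1 = 1 / 3 + 2 * (1 / 3) :> R)%R by lra.
  under eq_cvg do rewrite digit_meanE.
  by apply: cvgD => //; apply: cvgMr.
case: eqP => [->|a1].
  have I1 : outer (`[0%R, 1%R]%classic : set R) = 1.
    rewrite -[LHS]/(lebesgue_measure (`[0%R, 1%R]%classic : set R)).
    by rewrite lebesgue_measure_itv /= lte_fin ltr01 -EFinB subr0.
  (* [N] consists of abnormal points, so [Kset 1] is the unit interval minus a null set. *)
  pose N := (`[0%R, 1%R]%classic : set R) `\` Kset 1%R.
  have N0 : outer N = 0.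
    apply: sub_null => x [/=]; rewrite in_itv/= => x01 nK; split => // -[f1 f2].
    apply: nK; split; first by rewrite in_itv.
    - exact: normal_mean.
    - by rewrite rel_freqE; apply: cvgP f1.
    - by rewrite rel_freqE; apply: cvgP f2.
  have KE : Kset 1%R = (`[0%R, 1%R]%classic : set R) `\` N.
    rewrite /N setDD; apply/seteqP; split => [x Kx|x []//].
    by split => //; case: Kx.
  split.
    rewrite KE; apply: caratheodory_measurable_setD.
      by apply: sub_caratheodory; exact: measurable_itv.
    exact: outer_null_measurable.
  apply/eqP; rewrite eq_le; apply/andP; split.
    by rewrite -I1 le_outer_measure// KE; exact: subDsetl.
  rewrite -I1 -[leRHS]adde0 -N0; apply: le_trans (outer_measureU2 _ _ _).
  by apply: le_outer_measure => x xI; have [|] := pselect (Kset 1%R x); [left|right].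
(* Simply normal points have mean 1, so here every point of [Kset a] is abnormal. *)
have K0 : outer (Kset a) = 0.
  apply: sub_null => x [x01 xa _ _]; split; first by rewrite in_itv in x01.
  move=> nx; apply: a1; exact: (cvg_unique _ xa (normal_mean x nx)).
by split => //; exact: outer_null_measurable.
Qed.

End lebesgue_size.

(** * Cylinders that meet a small set *)

Section hausdorff_size.
Context {R : realType}.

(** The charge [q] falls on the level-[n] cylinder of index [u] and its neighbours. For [u = 0] the
    index [u.-1] is again 0, and that word is charged twice. *)
Definition near_words (n : nat) (q : R) (u : nat) (w : seq 'I_3) : \bar R :=
  if size w == n then (q * ((word_val w == u.-1)%:R + (word_val w == u)%:R +
    (word_val w == u.+1)%:R))%:E else 0%E.

(** Deleting the last [n] ternary digits of [v] gives [v %/ 3 ^ n], which must be the value of the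
    prefix [u]. In particular a value is taken by at most one word of each length. *)
Lemma level_sum_word_val (n v : nat) (u : seq 'I_3) :
  level_sum (fun w => ((word_val w == v)%:R : R)%:E) n u =
  ((word_val u == v %/ 3 ^ n)%N%:R)%:E.
Proof.
elim: n u => [|n IH] u /=; first by rewrite divn1.
under eq_bigr do rewrite IH word_val_rcons.
rewrite sumEFin -natr_sum expnSr divnMA; congr (_%:R)%:E.
set v' := (v %/ 3 ^ n)%N; rewrite !big_ord_recl big_ord0 /= /bump /=.
by do 4 case: eqP => /=; lia.
Qed.

Lemma total_cost_near_words n q u : 0 <= q ->
  (total_cost (near_words n q u) [::] <= (3 * q)%:E)%E.
Proof.
move=> q0; have ge0 m v : (0 <= ((word_val m == v)%:R : R)%:E)%E.
  by rewrite lee_fin.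
have nw0 w : (0 <= near_words n q u w)%E.
  by rewrite /near_words; case: ifP => // _; rewrite lee_fin mulr_ge0// !addr_ge0.
rewrite /total_cost (@nneseriesD1 _ _ n)//; last by move=> k _; exact: level_sum_ge0.
rewrite eseries0 ?adde0; last first.
  move=> k _ /andP[_ kn]; rewrite (@eq_level_sum _ _ (fun w => 0%:E * 0)%E).
    by rewrite level_sumZ// mul0e.
  by move=> w; rewrite add0n /near_words => ->; rewrite (negPf kn) mul0e.
rewrite (@eq_level_sum _ _ (fun w => q%:E * (((word_val w == u.-1)%:R : R)%:E +
    ((word_val w == u)%:R : R)%:E + ((word_val w == u.+1)%:R : R)%:E))%E); last first.
  by move=> w; rewrite add0n /near_words => ->; rewrite eqxx EFinM.
rewrite level_sumZ; last by move=> w; rewrite !adde_ge0.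
rewrite !level_sumD//; last by move=> w; rewrite adde_ge0.
rewrite !level_sum_word_val -!EFinD -EFinM lee_fin mulrC ler_wpM2r//.
have b1 (b : bool) : (b%:R : R) <= 1 by case: b.
rewrite (_ : 3 = 1 + 1 + 1) ?lerD//; lra.
Qed.

(** After scaling by [3 ^+ n], the points of [U] are at distance less than 1 from a fixed one, so
    their cylinders have indices at most 1 away from its integer part. *)
Lemma near_words_cover (U : set R) (r : R) (n : nat) :
  (forall x y, U x -> U y -> `|x - y| <= r) -> r < (1 / 3) ^+ n ->
  exists u, forall q y w, 0 <= q -> U y -> size w = n -> in_cylinder w y ->
    (q%:E <= near_words n q u w)%E.
Proof.
move=> Ur rn; have p3 : 0 < 3 ^+ n :> R by rewrite exprn_gt0.
have [[x Ux]|U0] := pselect (U !=set0); last first.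
  by exists 0%N => q y w _ Uy; case: U0; exists y.
exists (Num.truncn (x * 3 ^+ n)) => q y w q0 Uy sw; rewrite /in_cylinder sw.
have : `|x * 3 ^+ n - y * 3 ^+ n| < 1.
  rewrite -mulrBl normrM (gtr0_norm p3).
  move: rn; rewrite expr_div_n expr1n ltr_pdivlMr//; apply: le_lt_trans.
  by rewrite ler_pM2r// Ur.
move: (x * _) (y * _) => X Y; rewrite ltr_norml => /andP[xy1 xy2] /andP[wy1 wy2].
rewrite /near_words sw eqxx lee_fin -[leLHS]mulr1 ler_wpM2l//.
have key (u v : nat) : (v <= u.+1)%N -> (u <= v.+1)%N ->
    1 <= (v == u.-1)%:R + (v == u)%:R + (v == u.+1)%:R :> R.
  move=> vu uv; rewrite -!natrD ler1n.
  by do 3 case: eqP => /=; lia.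
have t2 := truncnS_gt (X); rewrite -natr1 in t2.
apply: key; first by rewrite -ltnS -(ltr_nat R) -!natr1; lra.
have [x0|x0] := leP 0 (X).
  by move: x0; rewrite -truncn_le -ltnS -(ltr_nat R) -!natr1; lra.
(* The chosen point of [U] may be negative, where [truncn] is 0. *)
by have -> : Num.truncn (X) = 0%N by apply/truncn0Pn; rewrite -ltNge; lra.
Qed.

Lemma exists_scale (M : nat) (e : R) : 0 < e -> e <= (1 / 3) ^+ M.+1 ->
  exists2 n, (M <= n)%N & (1 / 3) ^+ n.+1 <= e < (1 / 3) ^+ n.
Proof.
move=> e0 eM; have [N Ne] := @exists_small_expr R (1 / 3) e ltac:(lra) e0.
have exN : exists N, (1 / 3) ^+ N <= e by exists N.
have anti (i j : nat) : (i <= j)%N -> (1 / 3 : R) ^+ j <= (1 / 3) ^+ i.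
  by move=> ij; apply: ler_wiXn2l => //; lra.
case: (ex_minnP exN) => m me mmin.
have Mm : (M < m)%N.
  rewrite ltnNge; apply/negP => /anti Mm.
  have : (1 / 3 : R) ^+ M.+1 < (1 / 3) ^+ M.
    by rewrite exprS; have : 0 < (1 / 3 : R) ^+ M; [rewrite exprn_gt0//; lra|lra].
  lra.
exists m.-1; first by lia.
rewrite prednK; last by lia.
by rewrite me ltNge; apply/negP => /mmin; lia.
Qed.

End hausdorff_size.

(** * Lower bound for the Hausdorff dimension *)

Section hausdorff_lower_bound.
Context {R : realType}.

Lemma diam_pow_ge0 (s : R) (A : set R) : (0 <= diam_pow s A)%E.
Proof. by rewrite /diam_pow; case: ifP => // _; exact: poweR_ge0. Qed.

(** A real [r] replaces the diameter, with [r = 0] for the empty set, whose diameter is [-oo].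
    Raising the exponent lowers the power because [r <= 1]; at [r = 0] the power vanishes since
    [s' > 0]. *)
Lemma diam_pow_scale (s s' d : R) (A : set R) : 0 <= s <= s' -> 0 <= d <= 1 ->
  (diam A <= d%:E)%E ->
  exists r, [/\ 0 <= r <= d, forall x y, A x -> A y -> `|x - y| <= r &
    0 < s' -> ((r `^ s')%:E <= diam_pow s A)%E].
Proof.
move=> /andP[s0 ss'] /andP[d0 d1] Ad.
have [->|/set0P[x0 Ax0]] := eqVneq A set0.
  exists 0; rewrite lexx d0; split => // s'0.
  by rewrite powR0 ?gt_eqF// diam_pow_ge0.
have dist_le x y : A x -> A y -> (`|x - y|%:E <= diam A)%E.
  by move=> Ax Ay; apply: ereal_sup_ubound; exists x, y.
have diam0 : (0 <= diam A)%E.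
  by apply: le_trans (dist_le _ _ Ax0 Ax0); rewrite subrr normr0.
have diam_fin : diam A \is a fin_num.
  by rewrite ge0_fin_numE// (le_lt_trans Ad)// ltry.
exists (fine (diam A)); split.
- by rewrite fine_ge0//= -lee_fin fineK.
- by move=> x y Ax Ay; rewrite -lee_fin fineK// dist_le.
move=> s'0; rewrite /diam_pow ifF; last by apply/eqP => E; rewrite E in Ax0.
have r1 : fine (diam A) <= 1 by rewrite -lee_fin fineK// (le_trans Ad)// lee_fin.
rewrite -[X in (_ <= X `^ s)%E](fineK diam_fin) poweR_EFin lee_fin.
have := fine_ge0 diam0; rewrite le_eqVlt => /predU1P[<-|r0].
  by rewrite powR0 ?gt_eqF// powR_ge0.
by apply: ger_powR => //; rewrite r0.
Qed.

Lemma exists_cover_scale (s s' d eta : R) (M : nat) (A : set R) :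
  0 <= s <= s' -> 0 < s' -> 0 < eta -> d = (1 / 3) ^+ M.+1 -> (diam A <= d%:E)%E ->
  exists n u, [/\ (M <= n)%N,
    (((1 / 3 : R) `^ s' * ((1 / 3) `^ s') ^+ n)%:E <= diam_pow s A + eta%:E)%E &
    forall (q : R) y w, 0 <= q -> A y -> size w = n -> in_cylinder w y ->
      (q%:E <= near_words n q u w)%E].
Proof.
move=> ss' s'0 eta0 dE Ad.
have d0 : 0 < d by rewrite dE exprn_gt0//; lra.
have d1 : d <= 1 by rewrite dE exprn_ile1//; lra.
have [r [/andP[r0 rd] Ar rpow]] := @diam_pow_scale s s' d A ss' ltac:(lra) Ad.
(* A set of diameter 0 has no scale of its own; its diameter is raised to [tau], whose power of
   exponent [s'] is at most [eta]. *)
pose tau := Num.min d (eta `^ s'^-1).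
have tau0 : 0 < tau by rewrite lt_min d0 powR_gt0.
have taupow : tau `^ s' <= eta.
  apply: (@le_trans _ _ ((eta `^ s'^-1) `^ s')).
    by apply: ge0_ler_powR; rewrite ?nnegrE ?powR_ge0 ?ge_min ?lexx ?orbT// ltW.
  by rewrite -powRrM mulVf ?gt_eqF// powRr1// ltW.
pose e := Num.max r tau.
have e0 : 0 < e by rewrite lt_max tau0 orbT.
have ed : e <= (1 / 3) ^+ M.+1 by rewrite -dE ge_max rd ge_min lexx.
have epow : ((e `^ s')%:E <= diam_pow s A + eta%:E)%E.
  rewrite /e; case: (leP r tau) => _.
    by apply: (@le_trans _ _ eta%:E); rewrite ?lee_fin// leeDr// diam_pow_ge0.
  by apply: le_trans (rpow s'0) _; rewrite leeDl// lee_fin ltW.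
have [n Mn /andP[ne en]] := exists_scale e0 ed.
have rn : r < (1 / 3) ^+ n by apply: le_lt_trans en; rewrite le_max lexx.
have [u uP] := near_words_cover Ar rn.
exists n, u; split => //; apply: le_trans epow; rewrite lee_fin -exprS.
rewrite -powR_mulrn ?powR_ge0// powRAC powR_mulrn; last by lra.
by apply: ge0_ler_powR; rewrite ?nnegrE// ltW// exprn_gt0//; lra.
Qed.

(** When [k] is the entropy of [p], the summands are centered, and a deviation cost compares the
    weight with [expR (- k * n)]. *)
Lemma weight_ln (p : 'I_3 -> R) (k : R) (w : seq 'I_3) : (forall i, 0 < p i) ->
  weight p w = expR (\sum_(i <- w) (ln (p i) + k) - k * (size w)%:R).
Proof.
move=> p0; elim: w => [|i w IH].
  by rewrite /weight !big_nil mulr0 subrr expR0.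
rewrite /weight big_cons -/(weight p w) IH big_cons /= -natr1.
rewrite -[X in X * _ = _](lnK (p0 i)) -expRD; congr expR.
by ring.
Qed.

(** A mass distribution argument with [weight p] as the mass: typical words of length [n] weigh
    about [3 ^ (- n * h)], less than the charge [3 ^ (- n * s')] of the cover. *)
Lemma hausdorff_dim_Kset_ge (p : 'I_3 -> R) : (forall i, 0 < p i) ->
  \sum_i p i = 1 ->
  ((- (\sum_i p i * ln (p i)) / ln 3)%:E <=
   hausdorff_dim (Kset (p (Ordinal (isT : 1 < 3)%N) + 2 * p ord_max)))%E.
Proof.
move=> p0 p1; set a := _ + _; set h := _ / _.
have ln3 : 0 < ln (3 : R) by rewrite ln_gt0//; lra.
apply: le_ereal_inf_tmp => _ [s [s0 Hs] <-]; rewrite lee_fin leNgt; apply/negP => sh.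
(* The gap between [s'] and [h] absorbs the deviations of the logarithmic weights, and [s'] is
   positive even for [s = 0]. *)
pose s' := (s + h) / 2.
have s'0 : 0 < s' by rewrite /s'; lra.
have ss' : 0 <= s <= s' by apply/andP; split => //; rewrite /s'; lra.
have s'h : 0 < (h - s') * ln 3 by rewrite mulr_gt0// /s'; lra.
have pge0 i : 0 <= p i by rewrite ltW.
(* Three costs of total at most 1/4 each, for frequencies, logarithmic weights and the cover, stay
   below 1 together. *)
have q4 : 0 < 1 / 4 :> R by lra.
have ent : \sum_i p i * (ln (p i) + h * ln 3) = 0.
  under eq_bigr do rewrite mulrDr.
  by rewrite big_split /= -mulr_suml p1 mul1r /h divfK ?gt_eqF// subrr.
have [c3 [c30 tot3 dev3]] := deviation_cost pge0 p1 ent q4.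
have [cf [cf0 totf freqf]] := frequencies_cost pge0 p1 q4.
have [M MP] := dev3 _ s'h.
pose q : R := (1 / 3) `^ s'.
have q0 : 0 < q by rewrite powR_gt0//; lra.
(* The cover will cost at most [(3 / q) * (eta + eta)], which is 1/4. *)
pose eta := q / 24.
have eta0 : 0 < eta by rewrite /eta; lra.
(* Sets of diameter at most [d] get a scale [n >= M], where [MP] applies. *)
pose d : R := (1 / 3) ^+ M.+1.
have d0 : 0 < d by rewrite exprn_gt0//; lra.
have [_ [U [Ud UK] <-] Ueta] : exists2 y, [set (\sum_(0 <= k <oo) diam_pow s (U k))%E |
    U in [set U : (set R)^nat |
      (forall k, diam (U k) <= d%:E)%E /\ Kset a `<=` \bigcup_k U k]] y & (y < eta%:E)%E.
  apply: ereal_inf_lt; apply: (@le_lt_trans _ _ 0%E); last by rewrite lte_fin.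
  by rewrite -[leRHS]Hs; apply: ereal_sup_ubound; exists d.
have eta2 k : 0 < eta / (2 ^ k.+1)%:R by rewrite divr_gt0// ltr0n expn_gt0.
have /choice[nu nuP] (k : nat) : exists nu : nat * nat, [/\ (M <= nu.1)%N,
    ((q * q ^+ nu.1)%:E <= diam_pow s (U k) + (eta / (2 ^ k.+1)%:R)%:E)%E &
    forall (q' : R) y w, 0 <= q' -> U k y -> size w = nu.1 -> in_cylinder w y ->
      (q'%:E <= near_words nu.1 q' nu.2 w)%E].
  by have [n [u nuP]] := exists_cover_scale ss' s'0 (eta2 k) erefl (Ud k); exists (n, u).
pose cc k := near_words (nu k).1 (q ^+ (nu k).1) (nu k).2.
have cc0 k w : (0 <= cc k w)%E.
  rewrite /cc /near_words; case: ifP => // _.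
  rewrite lee_fin; apply: mulr_ge0; last by rewrite !addr_ge0.
  by apply: exprn_ge0; exact: ltW.
have totcc : (\sum_(k <oo) total_cost (cc k) [::] <= (1 / 4)%:E)%E.
  apply: (@le_trans _ _ (\sum_(k <oo) (3 / q)%:E *
      (diam_pow s (U k) + (eta / (2 ^ k.+1)%:R)%:E))%E).
    apply: lee_nneseries => [k _ _|k _]; first exact: total_cost_ge0.
    apply: le_trans (total_cost_near_words _ _ _) _; first by rewrite exprn_ge0// ltW.
    have [_ qk _] := nuP k; apply: le_trans (lee_wpmul2l _ qk).
      by rewrite -EFinM lee_fin mulrA divfK ?gt_eqF.
    by rewrite lee_fin divr_ge0// ltW.
  rewrite nneseriesZl; last first.
    by move=> k _; rewrite adde_ge0 ?diam_pow_ge0// lee_fin ltW.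
  apply: (@le_trans _ _ ((3 / q)%:E * (eta%:E + eta%:E))%E).
    apply: lee_wpmul2l; first by rewrite lee_fin divr_ge0// ltW.
    apply: le_trans (epsilon_trick _ _ (ltW eta0)) _ => [k|]; first exact: diam_pow_ge0.
    by rewrite leeD2r// ltW.
  rewrite -EFinD -EFinM lee_fin /eta le_eqVlt; apply/orP; left; apply/eqP.
  by field; rewrite gt_eqF.
pose cov w := (\sum_(k <oo) cc k w)%E.
have cov0 w : (0 <= cov w)%E by apply: nneseries_ge0.
pose c w := (cf w + c3 w + cov w)%E.
have c0 w : (0 <= c w)%E by rewrite !adde_ge0.
have totc : (total_cost c [::] < 1)%E.
  rewrite total_costD//; last by move=> w; rewrite adde_ge0.
  rewrite total_costD// total_cost_nneseries//.
  apply: le_lt_trans (leeD (leeD totf tot3) totcc) _.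
  by rewrite -!EFinD lte_fin; lra.
have [al alP] := exists_cheap_sequence c0 p1 totc.
have [f1 f2] : digit_freq al 1 @ \oo --> p (Ordinal (isT : 1 < 3)%N) /\
    digit_freq al 2 @ \oo --> p ord_max.
  apply: freqf => n; apply: le_lt_trans (alP n).
  by rewrite /c -addeA leeDl// adde_ge0.
have al3 n : (c3 (mkseq al n) < (weight p (mkseq al n))%:E)%E.
  apply: le_lt_trans (alP n).
  by rewrite /c -addeA addeCA leeDl// adde_ge0.
(* Hence [al] does not end in 2s and is the digit sequence of its sum. *)
have pmax1 : p ord_max < 1.
  rewrite -p1 (bigD1 ord_max)//= ltrDl (bigD1 ord0)//=.
  by rewrite ltr_pwDl// sumr_ge0.
have [x alx] := @exists_ternary_sum R al.
have /UK[k _ Ukx] : Kset a x.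
  by apply: Kset_of_freqs alx (freq_lt1_not_max f2 pmax1) f1 f2.
have [Mn _ near] := nuP k; set n := (nu k).1 in Mn near.
have xw : in_cylinder (mkseq al n) x by move/ternary_expansionP: alx.
(* A deviation below [(h - s') * ln 3 * n] leaves less than [- s' * ln 3 * n] in the exponent of the
   weight. *)
have wq : (weight p (mkseq al n)) <= q ^+ n.
  have dev : \sum_(i <- mkseq al n) (ln (p i) + h * ln 3) < (h - s') * ln 3 * n%:R.
    rewrite ltNge; apply/negP => le; have := MP (mkseq al n).
    by rewrite size_mkseq => /(_ Mn le); rewrite leNgt al3.
  rewrite (weight_ln (h * ln 3) _ p0) size_mkseq /q.
  rewrite -powR_mulrn ?powR_ge0// -powRrM /powR gt_eqF; last by lra.
  rewrite ler_expR div1r lnV ?posrE//.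
  by rewrite mulrN; lra.
(* The set containing [x] alone charges this prefix [q ^+ n], at least its weight, against the
   choice of [al]. *)
have := alP n; apply/negP; rewrite -leNgt.
apply: (@le_trans _ _ (q ^+ n)%:E); first by rewrite lee_fin.
apply: (@le_trans _ _ (cc k (mkseq al n))).
  by apply: (near _ x) => //; rewrite ?size_mkseq// exprn_ge0// ltW.
apply: (@le_trans _ _ (cov (mkseq al n))).
  exact: (@nneseries_ge_term _ (fun k => cc k (mkseq al n))).
by rewrite /c leeDr// adde_ge0.
Qed.

End hausdorff_lower_bound.

(** * The explicit probabilities and the conclusion *)

Lemma hausdorff_dim_ge0 {R : realType} (A : set R) : (0 <= hausdorff_dim A)%E.
Proof. by apply: le_ereal_inf_tmp => _ [s [s0 _] <-]; rewrite lee_fin. Qed.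

Theorem theorem3 (R : realType) (a : R) (ha : 0 <= a <= 2) :
  [/\ (Kset a #= [set: R])%card,
      `[0, 1]%classic `<=` closure (Kset a),
      lebesgue_measurable (Kset a) /\
      completed_lebesgue_measure (Kset a) = if a == 1 then 1%E else 0%E
    & let t := Num.sqrt (1 + 6 * a - 3 * a ^+ 2) in
      let p1 := (t - 1) / 3 in
      let p0 := (7 - 3 * a - t) / 6 in
      let p2 := (1 + 3 * a - t) / 6 in
      ((- (1 / ln 3) * ln (p1 `^ p1 * p0 `^ p0 * p2 `^ p2))%:E
         <= hausdorff_dim (Kset a))%E].
Proof.
split; [exact: Kset_continuum|exact: Kset_dense|exact: Kset_lebesgue|].
move=> t p1 p0 p2; case/andP: (ha) => a0 a2.
have D0 : 0 <= 1 + 6 * a - 3 * a ^+ 2 by nra.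
have t0 : 0 <= t by exact: sqrtr_ge0.
have tt : t ^+ 2 = 1 + 6 * a - 3 * a ^+ 2 by exact: sqr_sqrtr.
(* At [a = 0] and [a = 2] the vector is a point mass and the bound is 0, as [powR] takes the value 1
   at exponent 0. *)
have degenerate : t = 1 -> p0 = 0 \/ p2 = 0 ->
    ((- (1 / ln 3) * ln (p1 `^ p1 * p0 `^ p0 * p2 `^ p2))%:E
       <= hausdorff_dim (Kset a))%E.
  move=> t1 p02; have p1E : p1 = 0 by rewrite /p1; lra.
  suff -> : p1 `^ p1 * p0 `^ p0 * p2 `^ p2 = 1.
    by rewrite ln1 mulr0 hausdorff_dim_ge0.
  have [[p0E p2E]|[p0E p2E]] : (p0 = 0 /\ p2 = 1) \/ (p0 = 1 /\ p2 = 0).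
    case: p02; rewrite /p0 /p2 t1 => E; [left|right]; split; lra.
  - by rewrite p1E p0E p2E powRr0 powR1 !mulr1.
  - by rewrite p1E p0E p2E powRr0 powR1 !mulr1.
have [aE|/eqP a_neq0] := @eqP _ a 0.
  have t1 : t = 1 by rewrite aE in tt; nra.
  by apply: degenerate => //; right; rewrite /p2 t1; lra.
have [aE|/eqP a_neq2] := @eqP _ a 2.
  have t1 : t = 1 by rewrite aE in tt; nra.
  by apply: degenerate => //; left; rewrite /p0 t1; lra.
have {}a0 : 0 < a by rewrite lt_def a_neq0.
have {}a2 : a < 2 by rewrite lt_neqAle a_neq2.
(* Positivity rests on [t ^+ 2 - 1 = 3 * a * (2 - a)], [(7 - 3 * a) ^+ 2 - t ^+ 2 = 12 * (2 - a) ^+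
   2] and [(1 + 3 * a) ^+ 2 - t ^+ 2 = 12 * a ^+ 2]. *)
have p1_gt0 : 0 < p1 by rewrite /p1; nra.
have p0_gt0 : 0 < p0 by rewrite /p0; nra.
have p2_gt0 : 0 < p2 by rewrite /p2; nra.
pose p (i : 'I_3) := if val i == 0%N then p0 else if val i == 1%N then p1 else p2.
have p_gt0 i : 0 < p i by rewrite /p; case: (val i == 0%N) => //; case: (val i == 1%N).
have sum_p : \sum_i p i = 1.
  by rewrite !big_ord_recl big_ord0 /p /= /p0 /p1 /p2; lra.
have := hausdorff_dim_Kset_ge p_gt0 sum_p.
have -> : p (Ordinal (isT : 1 < 3)%N) + 2 * p ord_max = a.
  by rewrite /p /= /p1 /p2; lra.
apply: le_trans; rewrite lee_fin le_eqVlt; apply/orP; left; apply/eqP.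
rewrite !lnM ?posrE ?mulr_gt0 ?powR_gt0// (ln_powR p1) (ln_powR p0) (ln_powR p2).
rewrite !big_ord_recl big_ord0 /p /=.
by field; rewrite gt_eqF// ln_gt0//; lra.
Qed.
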